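(* The relation $\mathrm{TC}(e,\tau)$, viewed as a set of pairs $(e,\tau)$ with $e$ a closed expression of the core language and $\tau$ a type (generated by $\tau ::= \mathtt{int} \mid \mathtt{bool} \mid \tau\to\tau$), is co-recursively enumerable; that is, the set of pairs $(e,\tau)$ for which $\mathrm{TC}(e,\tau)$ fails is recursively enumerable.
   Context: **Core language.** Values: $v ::= n\ (n\in\mathbb Z) \mid b\ (b\in\mathbb B=\{\mathtt{true},\mathtt{false}\}) \mid \mathtt{fun}\ x \to e$. Expressions: $e ::= v \mid x \mid e\ e \mid e\odot e \mid \mathtt{if}\ e\ \mathtt{then}\ e\ \mathtt{else}\ e \mid e\sim p \mid \mathtt{pick\_i} \mid \mathtt{pick\_b} \mid \mathtt{ERROR}$, with $x$ a variable, $\odot\in\{+,-,<,=,\mathtt{and},\mathtt{or},\mathtt{xor}\}$ and patterns $p ::= \mathtt{int}\mid\mathtt{bool}\mid\mathtt{fun}$. $\mathtt{ERROR}$ is not a value. $\mathtt{let}\ x = e_1\ \mathtt{in}\ e_2$ abbreviates $(\mathtt{fun}\ x\to e_2)\ e_1$. Types: $\tau ::= \mathtt{int}\mid\mathtt{bool}\mid\tau\to\tau$. The language is untyped; bound, free and closed are standard. **Operational semantics.** Reduction contexts: $R ::= \bullet \mid R\ e \mid e\ R \mid R\odot e \mid v\odot R \mid \mathtt{if}\ R\ \mathtt{then}\ e\ \mathtt{else}\ e \mid R\sim p$; $R[[e]]$ is $R$ with $\bullet$ replaced by $e$. The single-step relation $\rightarrow^1$ on closed expressions is the least relation such that: (Red)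 if a redex $r\rightarrow^1 e$ by one of the basic rules below, then $R[[r]]\rightarrow^1 R[[e]]$; (Err) if $e\rightarrow^1\mathtt{ERROR}$, then $R[[e]]\rightarrow^1\mathtt{ERROR}$; also $R[[\mathtt{ERROR}]]\rightarrow^1\mathtt{ERROR}$ for $R\neq\bullet$. Basic rules: $n_1+n_2\rightarrow^1$ their integer sum if $n_1,n_2\in\mathbb Z$; $v_1+v_2\rightarrow^1\mathtt{ERROR}$ if $v_1$ or $v_2$ is not an integer; the other operators $\odot$ behave analogously (integer operands for $-,<,=$; boolean operands for $\mathtt{and},\mathtt{or},\mathtt{xor}$; otherwise $\mathtt{ERROR}$). $(\mathtt{fun}\ x\to e)\ v\rightarrow^1 e[v/x]$; $v\ v'\rightarrow^1\mathtt{ERROR}$ if $v$ is not a function value. $\mathtt{if}\ \mathtt{true}\ \mathtt{then}\ e\ \mathtt{else}\ e'\rightarrow^1 e$; $\mathtt{if}\ \mathtt{false}\ \mathtt{then}\ e\ \mathtt{else}\ e'\rightarrow^1 e'$; $\mathtt{if}\ v\ \mathtt{then}\ e\ \mathtt{else}\ e'\rightarrow^1\mathtt{ERROR}$ if $v$ is not boolean. $\mathtt{pick\_i}\rightarrow^1 n$ for every $n\in\mathbb Z$; $\mathtt{pick\_b}\rightarrow^1 b$ for every $b\in\mathbb B$. $v\sim p\rightarrow^1\mathtt{true}$ if $v$ is respectively an integer ($p=\mathtt{int}$), a boolean ($p=\mathtt{bool}$), a function value ($p=\mathtt{fun}$), and $v\sim p\rightarrow^1\mathtt{false}$ otherwise.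 $\rightarrow^*$ is the reflexive transitive closure of $\rightarrow^1$; $e\not\rightarrow^* e'$ is its negation. **Checkers and generators** (core-language expressions, defined by mutual recursion on $\tau$): - $\mathrm{Checker}(\mathtt{int},e)= e\sim\mathtt{int}$; $\mathrm{Checker}(\mathtt{bool},e)= e\sim\mathtt{bool}$. - $\mathrm{Checker}(\tau_1\to\tau_2,e)=\mathtt{if}\ e\sim\mathtt{fun}\ \mathtt{then}\ (\mathtt{let}\ arg=\mathrm{Generator}(\tau_1)\ \mathtt{in}\ \mathrm{Checker}(\tau_2,\,e\ arg))\ \mathtt{else}\ \mathtt{false}$. - $\mathrm{Generator}(\mathtt{int})=\mathtt{pick\_i}$; $\mathrm{Generator}(\mathtt{bool})=\mathtt{pick\_b}$. - $\mathrm{Generator}(\tau_1\to\tau_2)=\mathtt{fun}\ x\to \mathtt{if}\ \mathtt{pick\_b}\ \mathtt{then}\ (\mathtt{if}\ \mathrm{Checker}(\tau_1,x)\ \mathtt{then}\ \mathrm{Generator}(\tau_2)\ \mathtt{else}\ \mathtt{ERROR})\ \mathtt{else}\ \mathrm{Generator}(\tau_2)$. **Type checking relation.** $\mathrm{TC}(e,\tau)$ holds iff $\mathrm{Checker}(\tau,e)\not\rightarrow^*\mathtt{ERROR}$ and for all $v$, if $\mathrm{Checker}(\tau,e)\rightarrow^* v$ then $v=\mathtt{true}$. *)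

(* Defs.v *)
From Stdlib Require Import ZArith List Bool Relations Lia.
From Stdlib Require Cantor.
Import ListNotations.

(** * Core language *)

Definition var := nat.

Inductive op := Plus | Minus | Less | Equal | And | Or | Xor.

Inductive pat := PInt | PBool | PFun.

Inductive ty := TInt | TBool | TArr (t1 t2 : ty).

Inductive expr :=
| EInt (n : Z)
| EBool (b : bool)
| EFun (x : var) (e : expr)
| EVar (x : var)
| EApp (e1 e2 : expr)
| EOp (o : op) (e1 e2 : expr)
| EIf (e1 e2 e3 : expr)
| EIs (e : expr) (p : pat)
| EPickI
| EPickB
| EError.

Definition is_value (e : expr) : Prop :=
  match e with EInt _ | EBool _ | EFun _ _ => True | _ => False end.

Definition ELet (x : var) (e1 e2 : expr) : expr := EApp (EFun x e2) e1.

Fixpoint fv (e : expr) : list var :=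
  match e with
  | EVar x => [x]
  | EFun x e => remove Nat.eq_dec x (fv e)
  | EApp e1 e2 | EOp _ e1 e2 => fv e1 ++ fv e2
  | EIf e1 e2 e3 => fv e1 ++ fv e2 ++ fv e3
  | EIs e _ => fv e
  | EInt _ | EBool _ | EPickI | EPickB | EError => []
  end.

Definition closed (e : expr) : Prop := fv e = [].

(** [subst x v e] is e[v/x].  It does not rename binders: reduction is only
    considered on closed expressions and no reduction context has its hole under
    a binder, so the substituted value [v] is always closed. *)
Fixpoint subst (x : var) (v e : expr) : expr :=
  match e with
  | EVar y => if Nat.eqb y x then v else EVar y
  | EFun y e1 => if Nat.eqb y x then EFun y e1 else EFun y (subst x v e1)
  | EApp e1 e2 => EApp (subst x v e1) (subst x v e2)
  | EOp o e1 e2 => EOp o (subst x v e1) (subst x v e2)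
  | EIf e1 e2 e3 => EIf (subst x v e1) (subst x v e2) (subst x v e3)
  | EIs e1 p => EIs (subst x v e1) p
  | EInt _ | EBool _ | EPickI | EPickB | EError => e
  end.

(** * Operational semantics *)

Inductive ctx :=
| CHole
| CAppL (R : ctx) (e : expr)
| CAppR (e : expr) (R : ctx)
| COpL (o : op) (R : ctx) (e : expr)
| COpR (o : op) (v : expr) (Hv : is_value v) (R : ctx)
| CIf (R : ctx) (e1 e2 : expr)
| CIs (R : ctx) (p : pat).

Fixpoint plug (R : ctx) (e : expr) : expr :=
  match R with
  | CHole => e
  | CAppL R e2 => EApp (plug R e) e2
  | CAppR e1 R => EApp e1 (plug R e)
  | COpL o R e2 => EOp o (plug R e) e2
  | COpR o v _ R => EOp o v (plug R e)
  | CIf R e1 e2 => EIf (plug R e) e1 e2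
  | CIs R p => EIs (plug R e) p
  end.

Definition eval_op (o : op) (v1 v2 : expr) : expr :=
  match o, v1, v2 with
  | Plus, EInt n1, EInt n2 => EInt (n1 + n2)
  | Minus, EInt n1, EInt n2 => EInt (n1 - n2)
  | Less, EInt n1, EInt n2 => EBool (n1 <? n2)%Z
  | Equal, EInt n1, EInt n2 => EBool (n1 =? n2)%Z
  | And, EBool b1, EBool b2 => EBool (b1 && b2)
  | Or, EBool b1, EBool b2 => EBool (b1 || b2)
  | Xor, EBool b1, EBool b2 => EBool (xorb b1 b2)
  | _, _, _ => EError
  end.

Definition matches (v : expr) (p : pat) : bool :=
  match v, p with
  | EInt _, PInt | EBool _, PBool | EFun _ _, PFun => true
  | _, _ => false
  end.

Definition not_fun (v : expr) : Prop :=
  match v with EFun _ _ => False | _ => True end.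

Definition not_bool (v : expr) : Prop :=
  match v with EBool _ => False | _ => True end.

Inductive basic : expr -> expr -> Prop :=
| basic_op o v1 v2 :
    is_value v1 -> is_value v2 -> basic (EOp o v1 v2) (eval_op o v1 v2)
| basic_beta x e v :
    is_value v -> basic (EApp (EFun x e) v) (subst x v e)
| basic_app_error v v' :
    is_value v -> is_value v' -> not_fun v -> basic (EApp v v') EError
| basic_if_true e e' : basic (EIf (EBool true) e e') e
| basic_if_false e e' : basic (EIf (EBool false) e e') e'
| basic_if_error v e e' :
    is_value v -> not_bool v -> basic (EIf v e e') EError
| basic_pick_i n : basic EPickI (EInt n)
| basic_pick_b b : basic EPickB (EBool b)
| basic_is v p : is_value v -> basic (EIs v p) (EBool (matches v p)).

(** Only meaningful on closed expressions, which it preserves. *)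
Inductive step : expr -> expr -> Prop :=
| step_red R r e : basic r e -> step (plug R r) (plug R e)
| step_err R e : step e EError -> step (plug R e) EError
| step_error R : R <> CHole -> step (plug R EError) EError.

Definition steps : expr -> expr -> Prop := clos_refl_trans expr step.

(** * Checkers and generators *)

(** A bound variable chosen outside the free variables of [e]: in the nested
    [checker t2 (EApp e (EVar arg))], reusing one name for every [arg] would
    capture the outer one. *)
Definition fresh (e : expr) : var := S (list_max (fv e)).

(** The body of a generator at an arrow type contains no free variable but its own
    parameter, so any fixed name will do for it. *)
Definition gen_param : var := 0.

Fixpoint checker (t : ty) (e : expr) {struct t} : expr :=
  match t with
  | TInt => EIs e PInt
  | TBool => EIs e PBool
  | TArr t1 t2 =>
      let arg := fresh e in
      EIf (EIs e PFun)
          (ELet arg (generator t1) (checker t2 (EApp e (EVar arg))))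
          (EBool false)
  end
with generator (t : ty) {struct t} : expr :=
  match t with
  | TInt => EPickI
  | TBool => EPickB
  | TArr t1 t2 =>
      EFun gen_param
        (EIf EPickB
             (EIf (checker t1 (EVar gen_param)) (generator t2) EError)
             (generator t2))
  end.

Definition TC (e : expr) (t : ty) : Prop :=
  ~ steps (checker t e) EError /\
  forall v, is_value v -> steps (checker t e) v -> v = EBool true.

(** * Partial recursive functions and recursively enumerable sets *)

(** Terms for Kleene's mu-recursive functions.  Arities are left implicit: a
    function applied to too few arguments is undefined. *)
Inductive murec :=
| Zero
| Succ
| Proj (i : nat)
| Comp (f : murec) (gs : list murec)
| PrimRec (f g : murec)
| Mu (f : murec).

(** [computes f l n]: [f] is defined at the arguments [l], with value [n]. *)
Inductive computes : murec -> list nat -> nat -> Prop :=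
| computes_zero l : computes Zero l 0
| computes_succ n l : computes Succ (n :: l) (S n)
| computes_proj i l n : nth_error l i = Some n -> computes (Proj i) l n
| computes_comp f gs l ms n :
    Forall2 (fun g m => computes g l m) gs ms ->
    computes f ms n -> computes (Comp f gs) l n
| computes_rec_0 f g l n :
    computes f l n -> computes (PrimRec f g) (0 :: l) n
| computes_rec_S f g k l r n :
    computes (PrimRec f g) (k :: l) r -> computes g (k :: r :: l) n ->
    computes (PrimRec f g) (S k :: l) n
| computes_mu f l n :
    computes f (n :: l) 0 ->
    (forall m, m < n -> exists k, computes f (m :: l) (S k)) ->
    computes (Mu f) l n.

(** A set of naturals is r.e. iff it is the domain of a partial recursive function. *)
Definition re_nat (S : nat -> Prop) : Prop :=
  exists f : murec, forall n, S n <-> exists m, computes f [n] m.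

(** * Goedel numbering *)

Definition code_Z (z : Z) : nat :=
  if (z <? 0)%Z then 2 * Z.abs_nat z - 1 else 2 * Z.abs_nat z.

Definition code_op (o : op) : nat :=
  match o with
  | Plus => 0 | Minus => 1 | Less => 2 | Equal => 3
  | And => 4 | Or => 5 | Xor => 6
  end.

Definition code_pat (p : pat) : nat :=
  match p with PInt => 0 | PBool => 1 | PFun => 2 end.

Local Notation "'<<' x , y '>>'" := (Cantor.to_nat (x, y)).

Fixpoint code_expr (e : expr) : nat :=
  match e with
  | EInt n => << 0, code_Z n >>
  | EBool b => << 1, Nat.b2n b >>
  | EFun x e => << 2, << x, code_expr e >> >>
  | EVar x => << 3, x >>
  | EApp e1 e2 => << 4, << code_expr e1, code_expr e2 >> >>
  | EOp o e1 e2 => << 5, << code_op o, << code_expr e1, code_expr e2 >> >> >>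
  | EIf e1 e2 e3 =>
      << 6, << code_expr e1, << code_expr e2, code_expr e3 >> >> >>
  | EIs e p => << 7, << code_expr e, code_pat p >> >>
  | EPickI => << 8, 0 >>
  | EPickB => << 9, 0 >>
  | EError => << 10, 0 >>
  end.

Fixpoint code_ty (t : ty) : nat :=
  match t with
  | TInt => << 0, 0 >>
  | TBool => << 1, 0 >>
  | TArr t1 t2 => << 2, << code_ty t1, code_ty t2 >> >>
  end.

Definition closed_expr : Type := {e : expr | closed e}.

Definition code_pair (p : closed_expr * ty) : nat :=
  << code_expr (proj1_sig (fst p)), code_ty (snd p) >>.

Lemma code_Z_inj z z' : code_Z z = code_Z z' -> z = z'.
Proof.
  unfold code_Z.
  destruct (Z.ltb_spec z 0), (Z.ltb_spec z' 0); lia.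
Qed.

Lemma code_op_inj o o' : code_op o = code_op o' -> o = o'.
Proof. destruct o, o'; easy. Qed.

Lemma code_pat_inj p p' : code_pat p = code_pat p' -> p = p'.
Proof. destruct p, p'; easy. Qed.

Lemma code_expr_inj e e' : code_expr e = code_expr e' -> e = e'.
Proof.
  revert e'; induction e; intros []; cbn [code_expr]; intros H;
    repeat match goal with
      | H : Cantor.to_nat _ = Cantor.to_nat _ |- _ =>
          apply Cantor.to_nat_inj, pair_equal_spec in H as []
      end;
    try discriminate; f_equal;
    auto using code_Z_inj, code_op_inj, code_pat_inj, Nat.b2n_inj.
Qed.

Lemma code_ty_inj t t' : code_ty t = code_ty t' -> t = t'.
Proof.
  revert t'; induction t; intros []; cbn [code_ty]; intros H;
    repeat match goal with
      | H : Cantor.to_nat _ = Cantor.to_nat _ |- _ =>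
          apply Cantor.to_nat_inj, pair_equal_spec in H as []
      end;
    try discriminate; f_equal; auto.
Qed.

Definition recursively_enumerable (P : closed_expr * ty -> Prop) : Prop :=
  re_nat (fun n => exists p, code_pair p = n /\ P p).

Definition co_recursively_enumerable (P : closed_expr * ty -> Prop) : Prop :=
  recursively_enumerable (fun p => ~ P p).

Definition TC_pairs (p : closed_expr * ty) : Prop := TC (proj1_sig (fst p)) (snd p).

(* Main.v *)
Require Import Defs.
From Stdlib Require Import ZArith List Bool Relations Lia Classical Setoid.
From Stdlib Require Cantor.
Import ListNotations.

(** TC fails at a closed [e] exactly when some finite reduction sequence leads from the
    checker to ERROR or to a value other than true.  Scoping, substitution, reduction
    and the construction of the checker are all expressible by finitely many Horn
    clauses on Goedel numbers, and what a finite set of Horn clauses derives is r.e.: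
    a derivation is a finite sequence of (fact, substitution) pairs, each justified by
    earlier ones, so being the code of a derivation is primitive recursive and [Mu]
    searches for such a code. *)

(** * Primitive recursive terms *)

(** Horn clauses confine explicit [murec] terms to one generic program, a checker of coded
    derivations. Substitution, reduction and [checker] are never programmed as recursive functions,
    and the relations involved need be neither functional nor decidable. In particular [pick_i],
    with its infinitely many successors, is a single clause whose result is a variable constrained
    only to code an integer.

    The price is that clauses have no negation: distinct variables, failing pattern tests and
    operands of the wrong kind must each be derived positively, so inequality gets a predicate of
    its own. Moreover clauses range over all numbers, not all of which code something, so being the
    code of a closed expression or of a type has to be derivable as well. Soundness holds because
    the intended meaning of the predicates is a model of the clauses; completeness follows by
    simulating each rule of the semantics. *)

(** Junk value 0 on [Mu] and on lists that are too short; [computes_ev] only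
    speaks of [Mu]-free terms used at their arity. *)
Fixpoint ev (m : murec) (l : list nat) : nat :=
  match m with
  | Zero => 0
  | Succ => S (hd 0 l)
  | Proj i => nth i l 0
  | Comp f gs => ev f (map (fun g => ev g l) gs)
  | PrimRec f g =>
      nat_rect (fun _ => nat) (ev f (tl l)) (fun k r => ev g (k :: r :: tl l)) (hd 0 l)
  | Mu _ => 0
  end.

Fixpoint prim (m : murec) (k : nat) : bool :=
  match m with
  | Zero => true
  | Succ => 0 <? k
  | Proj i => i <? k
  | Comp f gs => prim f (length gs) && forallb (fun g => prim g k) gs
  | PrimRec f g => match k with 0 => false | S k => prim f k && prim g (S (S k)) end
  | Mu _ => false
  end.

(** Structural induction that also reaches the terms nested in the list argument of [Comp]. *)
Lemma murec_nested_ind (P : murec -> Prop) :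
  P Zero -> P Succ -> (forall i, P (Proj i)) ->
  (forall f gs, P f -> Forall P gs -> P (Comp f gs)) ->
  (forall f g, P f -> P g -> P (PrimRec f g)) ->
  (forall f, P f -> P (Mu f)) -> forall m, P m.
Proof.
  intros HZ HS HP HC HR HM.
  fix IH 1. intros [| |i|f gs|f g|f].
  - exact HZ.
  - exact HS.
  - apply HP.
  - apply HC; [apply IH|]. induction gs as [|g gs IHgs]; constructor; [apply IH | exact IHgs].
  - apply HR; apply IH.
  - apply HM, IH.
Qed.

(** Totality and determinism of [computes] in one equivalence. A search by [Mu] uses both: values
    must exist below the zero that is found, and a computed zero must be the value of [ev]. *)
Lemma computes_ev m l n :
  prim m (length l) = true -> computes m l n <-> n = ev m l.
Proof.
  revert l n. induction m as [| |i|f gs IHf IHgs|f g IHf IHg|f _]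
    using murec_nested_ind; cbn [ev prim]; intros l n Hl.
  - split; [now inversion 1 | intros ->; constructor].
  - destruct l as [|a l]; [discriminate|].
    split; [now inversion 1 | intros ->; constructor].
  - apply Nat.ltb_lt in Hl. split.
    + inversion 1 as [| |? ? ? Hn| | | |]; subst. symmetry. now apply nth_error_nth.
    + intros ->. constructor. now apply nth_error_nth'.
  - apply andb_prop in Hl as [Hf Hgs].
    assert (Hms : forall ms, Forall2 (fun g m => computes g l m) gs ms <->
                             ms = map (fun g => ev g l) gs).
    { clear Hf. induction IHgs as [|g gs Hg _ IH]; cbn in *; intros ms.
      - split; [now inversion 1 | intros ->; constructor].
      - apply andb_prop in Hgs as [H1 H2]. split.
        + inversion 1; subst. f_equal; [now apply Hg | now apply IH].
        + intros ->. constructor; [now apply Hg | now apply IH]. }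
    split.
    + inversion 1 as [| | |? ? ? ms ? H1 H2| | |]; subst.
      apply Hms in H1 as ->. apply IHf in H2; [easy|]. now rewrite length_map.
    + intros ->. econstructor; [now apply Hms|]. apply IHf; [|easy].
      now rewrite length_map.
  - destruct l as [|k l]; [discriminate|]. cbn [hd tl].
    apply andb_prop in Hl as [Hf Hg]. revert n.
    induction k as [|k IHk]; cbn [nat_rect]; intros n.
    + split.
      * inversion 1; subst. now apply IHf.
      * intros ->. constructor. now apply IHf.
    + split.
      * inversion 1; subst.
        match goal with H : computes (PrimRec f g) _ _ |- _ => apply IHk in H as -> end.
        now apply IHg.
      * intros ->. econstructor; [now apply IHk|]. now apply IHg.
  - discriminate.
Qed.

(** * Arithmetic, Cantor pairing and bounded quantification as recursive terms *)

Definition m_const (n : nat) : murec := Nat.iter n (fun m => Comp Succ [m]) Zero.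
Definition m_add (a b : murec) : murec :=
  Comp (PrimRec (Proj 0) (Comp Succ [Proj 1])) [a; b].
Definition m_mul (a b : murec) : murec :=
  Comp (PrimRec Zero (m_add (Proj 1) (Proj 2))) [a; b].
(** The recursion is on the subtrahend, hence the swapped arguments; the inner [PrimRec] is the
    predecessor. *)
Definition m_sub (a b : murec) : murec :=
  Comp (PrimRec (Proj 0) (Comp (PrimRec Zero (Proj 0)) [Proj 1])) [b; a].
Definition m_dist (a b : murec) : murec := m_add (m_sub a b) (m_sub b a).
(** Triangular numbers: [Cantor.to_nat (x, y)] is [y] plus the triangular number of [y + x]. *)
Definition m_sum : murec := PrimRec Zero (m_add (Comp Succ [Proj 0]) (Proj 1)).
Definition m_pair (a b : murec) : murec := m_add b (Comp m_sum [m_add b a]).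

(** The value at [n] is the diagonal [x + y] of the pair [(x, y)] coded by [n]. *)
Definition m_diag : murec :=
  PrimRec Zero
    (m_add (Proj 1)
       (m_sub (m_const 1) (m_sub (Comp m_sum [Comp Succ [Proj 1]]) (Comp Succ [Proj 0])))).
Definition m_snd (a : murec) : murec := m_sub a (Comp m_sum [Comp m_diag [a]]).
Definition m_fst (a : murec) : murec := m_sub (Comp m_diag [a]) (m_snd a).

(** Truth values are encoded with 0 for true, as [Mu] searches for zeros: then
    conjunctions are sums and disjunctions are products. *)
Definition m_all (f bound : murec) (args : list murec) : murec :=
  Comp (PrimRec Zero (m_add (Proj 1) (Comp f (Proj 0 :: map Proj (seq 2 (length args))))))
    (bound :: args).
Definition m_ex (f bound : murec) (args : list murec) : murec :=
  Comp (PrimRec (m_const 1)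
          (m_mul (Proj 1) (Comp f (Proj 0 :: map Proj (seq 2 (length args))))))
    (bound :: args).
Definition m_conj (ms : list murec) : murec := fold_right m_add Zero ms.
Definition m_disj (ms : list murec) : murec := fold_right m_mul (m_const 1) ms.

Lemma ev_const n l : ev (m_const n) l = n.
Proof. induction n; cbn in *; auto. Qed.

Lemma ev_add a b l : ev (m_add a b) l = ev a l + ev b l.
Proof. cbn. induction (ev a l); cbn; auto. Qed.

Lemma ev_mul a b l : ev (m_mul a b) l = ev a l * ev b l.
Proof.
  cbn -[m_add]. induction (ev a l) as [|n IH]; cbn [nat_rect Nat.mul]; [easy|].
  rewrite ev_add. cbn [ev nth]. rewrite IH. lia.
Qed.

Lemma ev_sub a b l : ev (m_sub a b) l = ev a l - ev b l.
Proof.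
  cbn. induction (ev b l) as [|n IH]; cbn; [lia|].
  rewrite IH.
  replace (ev a l - S n) with (pred (ev a l - n)) by lia. now destruct (ev a l - n).
Qed.

Lemma ev_dist a b l : ev (m_dist a b) l = 0 <-> ev a l = ev b l.
Proof. unfold m_dist. rewrite ev_add, !ev_sub. lia. Qed.

Definition sum_to (n : nat) : nat := nat_rect (fun _ => nat) 0 (fun i m => S i + m) n.

Lemma ev_sum n : ev m_sum [n] = sum_to n.
Proof.
  unfold m_sum, sum_to. cbn [ev hd tl].
  induction n as [|n IH]; cbn [nat_rect]; [easy|].
  rewrite ev_add. cbn [ev map nth hd]. now rewrite IH.
Qed.

Lemma ev_pair a b l : ev (m_pair a b) l = Cantor.to_nat (ev a l, ev b l).
Proof.
  unfold m_pair. rewrite ev_add. cbn [ev map].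
  rewrite ev_sum, ev_add. reflexivity.
Qed.

Lemma sum_to_S n : sum_to (S n) = S n + sum_to n.
Proof. reflexivity. Qed.

Lemma sum_to_lt m n : m < n -> sum_to m + m < sum_to n.
Proof. induction 1; rewrite sum_to_S; lia. Qed.

(** From [n] to [S n] the diagonal grows by one exactly when [S n] reaches the next triangular
    number. The truncated difference from 1 in [m_diag] is 1 in that case and 0 otherwise. *)
Lemma ev_diag_bounds n :
  sum_to (ev m_diag [n]) <= n < sum_to (S (ev m_diag [n])).
Proof.
  induction n as [|n IH]; [cbn; lia|].
  assert (ev m_diag [S n] =
          ev m_diag [n] + (1 - (sum_to (S (ev m_diag [n])) - S n))) as ->.
  { unfold m_diag at 1. cbn [ev hd tl nat_rect].
    rewrite ev_add, !ev_sub, ev_const. cbn [ev map nth hd].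
    rewrite ev_sum. reflexivity. }
  set (r := ev m_diag [n]) in *. rewrite !sum_to_S in *.
  destruct (Nat.eq_dec (S n) (S r + sum_to r)).
  - replace (r + _) with (S r) by lia. rewrite !sum_to_S. lia.
  - replace (r + _) with r by lia. lia.
Qed.

(** Since [y <= y + x], the code of [(x, y)] lies below the next triangular number after that of
    [y + x], and the intervals between consecutive triangular numbers are disjoint. *)
Lemma ev_diag x y : ev m_diag [Cantor.to_nat (x, y)] = y + x.
Proof.
  pose proof (ev_diag_bounds (Cantor.to_nat (x, y))) as H.
  set (r := ev _ _) in *.
  assert (E : Cantor.to_nat (x, y) = y + sum_to (y + x)) by reflexivity.
  rewrite E in H. rewrite sum_to_S in H.
  destruct (Nat.lt_trichotomy r (y + x)) as [Hr|[Hr|Hr]]; [|easy|];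
    apply sum_to_lt in Hr as Hr'; lia.
Qed.

Lemma ev_snd a l : ev (m_snd a) l = snd (Cantor.of_nat (ev a l)).
Proof.
  unfold m_snd. rewrite ev_sub. cbn [ev map]. rewrite ev_sum.
  rewrite <- (Cantor.cancel_to_of (ev a l)).
  destruct (Cantor.of_nat (ev a l)) as [x y].
  rewrite ev_diag, Cantor.cancel_of_to.
  change (Cantor.to_nat (x, y)) with (y + sum_to (y + x)). cbn [snd]. lia.
Qed.

Lemma ev_fst a l : ev (m_fst a) l = fst (Cantor.of_nat (ev a l)).
Proof.
  unfold m_fst. rewrite ev_sub, ev_snd. cbn [ev map].
  rewrite <- (Cantor.cancel_to_of (ev a l)) at 1.
  destruct (Cantor.of_nat (ev a l)) as [x y]. rewrite ev_diag. cbn [fst snd]. lia.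
Qed.

(** The prefix is arbitrary so that induction can move the head of [l] into it. The case of interest
    is a prefix of two: the counter and the accumulated value that a [PrimRec] step receives before
    its parameters. *)
Lemma map_ev_proj l pre :
  map (fun g => ev g (pre ++ l)) (map Proj (seq (length pre) (length l))) = l.
Proof.
  revert pre. induction l as [|a l IH]; intros pre; cbn; [easy|].
  rewrite nth_middle. f_equal.
  specialize (IH (pre ++ [a])). rewrite <- app_assoc, length_app, Nat.add_1_r in IH.
  exact IH.
Qed.

Lemma map_ev_proj2 {A} i r l (args : list A) :
  length l = length args ->
  map (fun g => ev g (i :: r :: l)) (map Proj (seq 2 (length args))) = l.
Proof. intros <-. apply (map_ev_proj l [i; r]). Qed.

Lemma ev_all f bound args l :
  ev (m_all f bound args) l = 0 <->
  forall i, i < ev bound l -> ev f (i :: map (fun g => ev g l) args) = 0.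
Proof.
  unfold m_all. cbn [ev map hd tl]. induction (ev bound l) as [|n IH];
    cbn [nat_rect].
  - split; [lia | easy].
  - rewrite ev_add. cbn [ev map nth].
    rewrite map_ev_proj2 by now rewrite length_map.
    rewrite Nat.eq_add_0. rewrite IH. split.
    + intros [H1 H2] i Hi. destruct (Nat.eq_dec i n) as [->|]; [easy|]. apply H1. lia.
    + intros H. split; [intros i Hi|]; apply H; lia.
Qed.

Lemma ev_ex f bound args l :
  ev (m_ex f bound args) l = 0 <->
  exists i, i < ev bound l /\ ev f (i :: map (fun g => ev g l) args) = 0.
Proof.
  unfold m_ex. cbn [ev map hd tl]. induction (ev bound l) as [|n IH];
    cbn [nat_rect].
  - split; [easy | intros [i [Hi _]]; lia].
  - rewrite ev_mul. cbn [ev map nth].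
    rewrite map_ev_proj2 by now rewrite length_map.
    rewrite Nat.eq_mul_0. rewrite IH. split.
    + intros [[i [Hi H]]|H]; [exists i | exists n]; split; auto; lia.
    + intros [i [Hi H]]. destruct (Nat.eq_dec i n) as [->|]; [now right|].
      left. exists i. split; [lia | easy].
Qed.

Lemma ev_conj {A} (f : A -> murec) xs l :
  ev (m_conj (map f xs)) l = 0 <-> forall x, In x xs -> ev (f x) l = 0.
Proof.
  induction xs as [|x xs IH]; cbn [map m_conj fold_right].
  - split; easy.
  - rewrite ev_add, Nat.eq_add_0. unfold m_conj in IH. rewrite IH. cbn [In].
    split; [intros [H1 H2] y [<-|Hy]; auto | auto].
Qed.

Lemma ev_disj {A} (f : A -> murec) xs l :
  ev (m_disj (map f xs)) l = 0 <-> exists x, In x xs /\ ev (f x) l = 0.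
Proof.
  induction xs as [|x xs IH]; cbn [map m_disj fold_right].
  - rewrite ev_const. split; [easy | intros [x [[] _]]].
  - rewrite ev_mul, Nat.eq_mul_0. unfold m_disj in IH. rewrite IH. cbn [In].
    split.
    + intros [H|[y [Hy H]]]; eauto.
    + intros [y [[<-|Hy] H]]; eauto.
Qed.

(** * Membership of these terms in the [Mu]-free fragment, at their arities *)

Lemma prim_const n k : prim (m_const n) k = true.
Proof. induction n as [|n IH]; [easy|]. cbn. now rewrite andb_true_r. Qed.

Lemma prim_add a b k : prim a k = true -> prim b k = true -> prim (m_add a b) k = true.
Proof. cbn. now intros -> ->. Qed.

Lemma prim_mul a b k : prim a k = true -> prim b k = true -> prim (m_mul a b) k = true.
Proof. cbn. now intros -> ->. Qed.

Lemma prim_dist a b k : prim a k = true -> prim b k = true -> prim (m_dist a b) k = true.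
Proof. cbn. now intros -> ->. Qed.

Lemma prim_pair a b k : prim a k = true -> prim b k = true -> prim (m_pair a b) k = true.
Proof. cbn. now intros -> ->. Qed.

Lemma forallb_prim_proj n m : forallb (fun g => prim g (n + m)) (map Proj (seq n m)) = true.
Proof.
  apply forallb_forall. intros g Hg. apply in_map_iff in Hg as [i [<- Hi]].
  apply in_seq in Hi. now apply Nat.ltb_lt.
Qed.

Lemma prim_all f bound args k :
  prim f (S (length args)) = true -> prim bound k = true ->
  forallb (fun g => prim g k) args = true -> prim (m_all f bound args) k = true.
Proof.
  intros Hf Hb Ha. pose proof (forallb_prim_proj 2 (length args)) as Hp.
  cbn in *. rewrite length_map, length_seq. now rewrite Hf, Hb, Ha, Hp.
Qed.

Lemma prim_ex f bound args k :
  prim f (S (length args)) = true -> prim bound k = true ->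
  forallb (fun g => prim g k) args = true -> prim (m_ex f bound args) k = true.
Proof.
  intros Hf Hb Ha. pose proof (forallb_prim_proj 2 (length args)) as Hp.
  cbn in *. rewrite length_map, length_seq. now rewrite Hf, Hb, Ha, Hp.
Qed.

Lemma prim_conj {A} (f : A -> murec) xs k :
  (forall x, prim (f x) k = true) -> prim (m_conj (map f xs)) k = true.
Proof. intros H. induction xs; [easy|]. now apply prim_add. Qed.

Lemma prim_disj {A} (f : A -> murec) xs k :
  (forall x, prim (f x) k = true) -> prim (m_disj (map f xs)) k = true.
Proof. intros H. induction xs; [easy|]. now apply prim_mul. Qed.

(** * Horn clauses over the natural numbers *)

(** A number seen as an infinite sequence, by iterated unpairing. *)
Definition entry (s i : nat) : nat :=
  fst (Cantor.of_nat (Nat.iter i (fun x => snd (Cantor.of_nat x)) s)).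

Definition code_list (l : list nat) : nat :=
  fold_right (fun x c => Cantor.to_nat (x, c)) 0 l.

(** The empty list may be coded by 0 since [Cantor.to_nat (0, 0) = 0]. *)
Lemma entry_code_list l i : entry (code_list l) i = nth i l 0.
Proof.
  unfold entry. revert l. induction i as [|i IH]; intros [|x l].
  - reflexivity.
  - unfold code_list. cbn [fold_right Nat.iter nat_rect]. now rewrite Cantor.cancel_of_to.
  - specialize (IH []). cbn [code_list fold_right] in *. rewrite Nat.iter_succ_r.
    change (snd (Cantor.of_nat 0)) with 0. rewrite IH. now destruct i.
  - rewrite Nat.iter_succ_r. cbn [code_list fold_right nth].
    rewrite Cantor.cancel_of_to. apply IH.
Qed.

Definition m_entry (s i : murec) : murec :=
  m_fst (Comp (PrimRec (Proj 0) (m_snd (Proj 1))) [i; s]).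

Lemma ev_entry s i l : ev (m_entry s i) l = entry (ev s l) (ev i l).
Proof.
  unfold m_entry, entry. rewrite ev_fst. cbn [ev map hd tl nth]. do 2 f_equal.
  induction (ev i l) as [|n IH]; cbn [nat_rect Nat.iter]; [easy|].
  rewrite ev_snd. cbn [ev nth]. now rewrite IH.
Qed.

Lemma prim_entry s i k : prim s k = true -> prim i k = true -> prim (m_entry s i) k = true.
Proof. cbn. now intros -> ->. Qed.

(** Besides pairing, successor and addition suffice to express inequality and integer arithmetic
    positively, for instance by letting one argument be [x] and another [x + S d]. Terms are only
    evaluated under guessed substitutions, so no unification is involved. *)
Inductive term :=
| Var (i : nat)
| Cst (n : nat)
| Suc (t : term)
| Add (t1 t2 : term)
| Pair (t1 t2 : term).

Fixpoint eval (s : nat -> nat) (t : term) : nat :=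
  match t with
  | Var i => s i
  | Cst n => n
  | Suc t => S (eval s t)
  | Add t1 t2 => eval s t1 + eval s t2
  | Pair t1 t2 => Cantor.to_nat (eval s t1, eval s t2)
  end.

Lemma eval_ext s s' t : (forall i, s i = s' i) -> eval s t = eval s' t.
Proof. intros H. induction t; cbn [eval]; congruence. Qed.

Fixpoint m_term (s : murec) (t : term) : murec :=
  match t with
  | Var i => m_entry s (m_const i)
  | Cst n => m_const n
  | Suc t => Comp Succ [m_term s t]
  | Add t1 t2 => m_add (m_term s t1) (m_term s t2)
  | Pair t1 t2 => m_pair (m_term s t1) (m_term s t2)
  end.

Lemma ev_term s t l : ev (m_term s t) l = eval (entry (ev s l)) t.
Proof.
  induction t; cbn [m_term eval].
  - now rewrite ev_entry, ev_const.
  - apply ev_const.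
  - cbn. congruence.
  - rewrite ev_add. congruence.
  - rewrite ev_pair. congruence.
Qed.

Lemma prim_term s t k : prim s k = true -> prim (m_term s t) k = true.
Proof.
  intros Hs. induction t; cbn [m_term].
  - apply prim_entry; auto using prim_const.
  - apply prim_const.
  - cbn. now rewrite IHt.
  - now apply prim_add.
  - now apply prim_pair.
Qed.

(** * Derivability from clauses and its coded derivations *)

Record clause := Clause { head : term; body : list term }.

(** A substitution is a single number read as a sequence by [entry], so that it can be stored in a
    coded derivation; nothing is lost, as a clause has finitely many variables. *)
Inductive derivable (P : list clause) : nat -> Prop :=
| derivable_clause c s :
    In c P -> (forall b, In b (body c) -> derivable P (eval (entry s) b)) ->
    derivable P (eval (entry s) (head c)).

(** [f i] is the [i]-th derived fact, with the substitution of the clause that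
    derives it from earlier facts. *)
Definition derivation (P : list clause) (f : nat -> nat * nat) (n : nat) : Prop :=
  forall i, i < n -> exists c, In c P /\
    fst (f i) = eval (entry (snd (f i))) (head c) /\
    forall b, In b (body c) -> exists j, j < i /\ fst (f j) = eval (entry (snd (f i))) b.

Lemma derivation_sound P f n i : derivation P f n -> i < n -> derivable P (fst (f i)).
Proof.
  intros Hf. induction i as [i IH] using (well_founded_induction lt_wf). intros Hi.
  destruct (Hf i Hi) as [c [Hc [-> Hb]]]. constructor; [easy|].
  intros b Hin. destruct (Hb b Hin) as [j [Hj <-]]. apply IH; lia.
Qed.

Definition list_derivation P (l : list (nat * nat)) : Prop :=
  derivation P (fun i => nth i l (0, 0)) (length l).

Lemma list_derivation_app P l1 l2 :
  list_derivation P l1 -> list_derivation P l2 -> list_derivation P (l1 ++ l2).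
Proof.
  intros H1 H2 i Hi. rewrite length_app in Hi.
  destruct (Nat.lt_ge_cases i (length l1)) as [Hlt|Hge].
  - destruct (H1 i Hlt) as [c [Hc [Hh Hb]]]. exists c.
    rewrite app_nth1 by easy. split; [easy|]. split; [easy|].
    intros b Hin. destruct (Hb b Hin) as [j [Hj E]]. exists j.
    rewrite app_nth1 by lia. easy.
  - destruct (H2 (i - length l1)) as [c [Hc [Hh Hb]]]; [lia|]. exists c.
    rewrite app_nth2 by easy. split; [easy|]. split; [easy|].
    intros b Hin. destruct (Hb b Hin) as [j [Hj E]]. exists (length l1 + j).
    rewrite app_nth2_plus. split; [lia|easy].
Qed.

(** Derivations of the premises are concatenated and the conclusion is appended, so every premise
    stands at a smaller index. *)
Lemma derivable_list_derivation P x :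
  derivable P x -> exists l, list_derivation P l /\ In x (map fst l).
Proof.
  induction 1 as [c s Hc _ IH].
  assert (exists l, list_derivation P l /\
            forall b, In b (body c) -> In (eval (entry s) b) (map fst l)) as [l [Hl Hb]].
  { induction (body c) as [|b bs IHbs].
    - exists []. split; [intros i Hi; cbn in Hi; lia | easy].
    - destruct (IH b (or_introl eq_refl)) as [l1 [H1 E1]].
      destruct IHbs as [l2 [H2 E2]]; [intros b' Hb'; apply IH; now right|].
      exists (l1 ++ l2). split; [now apply list_derivation_app|].
      rewrite map_app. intros b' [<-|Hb']; apply in_or_app; auto. }
  exists (l ++ [(eval (entry s) (head c), s)]). split.
  - intros i Hi. rewrite length_app in Hi. cbn in Hi.
    destruct (Nat.lt_ge_cases i (length l)) as [Hlt|Hge].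
    + destruct (Hl i Hlt) as [c' [Hc' [Hh' Hb']]]. exists c'.
      rewrite app_nth1 by easy. split; [easy|]. split; [easy|].
      intros b Hin. destruct (Hb' b Hin) as [j [Hj E]]. exists j.
      rewrite app_nth1 by lia. easy.
    + assert (i = length l) as -> by lia. rewrite nth_middle. exists c.
      split; [easy|]. split; [easy|].
      intros b Hin. apply Hb in Hin. apply In_nth with (d := 0) in Hin as [j [Hj E]].
      rewrite length_map in Hj. exists j. split; [easy|].
      rewrite app_nth1 by easy. cbn [snd]. rewrite <- E. symmetry. apply (map_nth fst l (0, 0)).
  - rewrite map_app. apply in_or_app. right. now left.
Qed.

(** The arguments are a position and the code of a sequence. Under [m_ex] they become the position
    of a candidate premise, the sequence, and the value sought; that value is computed outside
    because its substitution is stored at the outer position. *)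
Definition m_justified (P : list clause) : murec :=
  let fact i := m_fst (m_entry (Proj 1) i) in
  let subst := m_snd (m_entry (Proj 1) (Proj 0)) in
  m_disj (map (fun c =>
    m_add (m_dist (fact (Proj 0)) (m_term subst (head c)))
      (m_conj (map (fun b =>
         m_ex (m_dist (m_fst (m_entry (Proj 1) (Proj 0))) (Proj 2))
           (Proj 0) [Proj 1; m_term subst b]) (body c)))) P).

(** [Proj 0] codes a pair of a sequence and its length; [x] is the fact to be found in it and may
    depend on the input [Proj 1]. *)
Definition m_proof_of (P : list clause) (x : murec) : murec :=
  m_add
    (m_all (m_justified P) (m_snd (Proj 0)) [m_fst (Proj 0)])
    (m_ex (m_dist (m_fst (m_entry (Proj 1) (Proj 0))) (Proj 2))
       (m_snd (Proj 0)) [m_fst (Proj 0); x]).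

Lemma ev_justified P n s :
  (forall i, i < n -> ev (m_justified P) [i; s] = 0) <->
  derivation P (fun i => Cantor.of_nat (entry s i)) n.
Proof.
  unfold m_justified, derivation.
  setoid_rewrite ev_disj. setoid_rewrite ev_add. setoid_rewrite Nat.eq_add_0.
  setoid_rewrite ev_dist. setoid_rewrite ev_conj. setoid_rewrite ev_ex. cbn [map].
  setoid_rewrite ev_dist. setoid_rewrite ev_fst. setoid_rewrite ev_term.
  setoid_rewrite ev_snd. setoid_rewrite ev_entry. reflexivity.
Qed.

Lemma proof_of_sound P x n :
  (exists w, ev (m_proof_of P x) [w; n] = 0) -> exists w, derivable P (ev x [w; n]).
Proof.
  intros [w H]. exists w. unfold m_proof_of in H.
  rewrite ev_add, Nat.eq_add_0, ev_all, ev_ex in H. cbn [map] in H.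
  rewrite !ev_fst, !ev_snd in H. cbn [ev nth] in H. destruct H as [H [i [Hi Hx]]].
  apply ev_justified in H. apply (derivation_sound _ _ _ _ H) in Hi.
  rewrite ev_dist, ev_fst, ev_entry in Hx. cbn [ev nth] in Hx. congruence.
Qed.

Lemma derivable_proof_of P p n :
  derivable P (Cantor.to_nat (p, n)) <->
  exists w, ev (m_proof_of P (m_pair (m_const p) (Proj 1))) [w; n] = 0.
Proof.
  split.
  - intros H. apply derivable_list_derivation in H as [l [Hl Hx]].
    exists (Cantor.to_nat (code_list (map Cantor.to_nat l), length l)).
    unfold m_proof_of. rewrite ev_add, Nat.eq_add_0, ev_all, ev_ex. cbn [map].
    rewrite !ev_fst, !ev_snd, ev_pair, ev_const. cbn [ev nth].
    rewrite Cantor.cancel_of_to. cbn [fst snd].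
    assert (He : forall i,
              Cantor.of_nat (entry (code_list (map Cantor.to_nat l)) i) = nth i l (0, 0)).
    { intros i. rewrite entry_code_list.
      (* The default 0 of [nth] is the code of [(0, 0)], which is what [map_nth] requires. *)
      change 0 with (Cantor.to_nat (0, 0)) at 1. rewrite map_nth.
      apply Cantor.cancel_of_to. }
    split.
    + apply ev_justified. intros i Hi. destruct (Hl i Hi) as [c Hc]. exists c.
      rewrite He. destruct Hc as [H1 [H2 H3]]. repeat split; auto.
      intros b Hb. destruct (H3 b Hb) as [j Hj]. exists j. now rewrite He.
    + apply In_nth with (d := 0) in Hx as [i [Hi E]]. rewrite length_map in Hi.
      exists i. split; [easy|]. rewrite ev_dist, ev_fst, ev_entry. cbn [ev nth].
      rewrite He, <- E. symmetry. apply (map_nth fst l (0, 0)).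
  - intros H. apply proof_of_sound in H as [w H].
    rewrite ev_pair, ev_const in H. exact H.
Qed.

Lemma prim_proof_of P x : prim x 2 = true -> prim (m_proof_of P x) 2 = true.
Proof.
  intros Hx. unfold m_proof_of. apply prim_add.
  - apply prim_all; [|easy|easy].
    unfold m_justified. apply prim_disj. intros c. apply prim_add.
    + apply prim_dist; [easy|]. now apply prim_term.
    + apply prim_conj. intros b. apply prim_ex; [easy|easy|].
      cbn [forallb]. now rewrite prim_term.
  - apply prim_ex; [easy|easy|]. cbn [forallb]. now rewrite Hx.
Qed.

Theorem derivable_re P p : re_nat (fun n => derivable P (Cantor.to_nat (p, n))).
Proof.
  set (m := m_proof_of P (m_pair (m_const p) (Proj 1))).
  assert (Hm : forall w n k, computes m [w; n] k <-> k = ev m [w; n]).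
  { intros w n k. apply computes_ev. apply prim_proof_of, prim_pair; auto using prim_const. }
  exists (Mu m). intros n. rewrite derivable_proof_of. split.
  (* [computes_mu] asks for the least zero, with successor values below it, and not merely for some
     zero. *)
  - intros H. apply dec_inh_nat_subset_has_unique_least_element in H.
    + destruct H as [w [[Hw Hmin] _]]. exists w. constructor.
      * now apply Hm.
      * intros v Hv. destruct (ev m [v; n]) as [|k] eqn:E.
        -- apply Hmin in E. lia.
        -- exists k. now apply Hm.
    + intros w. destruct (Nat.eq_dec (ev m [w; n]) 0); auto.
  - intros [w H]. exists w. inversion H; subst.
    match goal with H : computes m _ 0 |- _ => now apply Hm in H end.
Qed.

(** * The type checker as a set of Horn clauses *)

Local Opaque Cantor.to_nat.

Fixpoint term_vars (t : term) : nat :=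
  match t with
  | Var i => S i
  | Cst _ => 0
  | Suc t => term_vars t
  | Add t1 t2 | Pair t1 t2 => Nat.max (term_vars t1) (term_vars t2)
  end.

Definition clause_vars (c : clause) : nat :=
  fold_right Nat.max (term_vars (head c)) (map term_vars (body c)).

(** Together with [forall_nats], this makes a concrete clause compute to a plain quantified chain of
    implications that tactics can apply or split. *)
Definition clause_holds (X : nat -> Prop) (s : nat -> nat) (c : clause) : Prop :=
  fold_right (fun b Q => X (eval s b) -> Q) (X (eval s (head c))) (body c).

Fixpoint forall_nats (n : nat) (Q : list nat -> Prop) : Prop :=
  match n with
  | 0 => Q []
  | S n => forall x, forall_nats n (fun l => Q (x :: l))
  end.

Lemma forall_nats_intro n (Q : list nat -> Prop) : (forall l, Q l) -> forall_nats n Q.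
Proof. revert Q. induction n; cbn; auto. Qed.

Lemma clause_holds_iff X s c :
  clause_holds X s c <->
  ((forall b, In b (body c) -> X (eval s b)) -> X (eval s (head c))).
Proof.
  unfold clause_holds. induction (body c) as [|b bs IH]; cbn [fold_right In].
  - firstorder.
  - rewrite IH. split.
    + intros H Hb. apply H; auto.
    + intros H Hb Hbs. apply H. intros b' [<-|Hb']; auto.
Qed.

Lemma derivable_intro P c :
  In c P ->
  forall_nats (clause_vars c) (fun l => clause_holds (derivable P) (fun i => nth i l 0) c).
Proof.
  intros Hc. apply forall_nats_intro. intros l. apply clause_holds_iff. intros Hb.
  rewrite (eval_ext _ (entry (code_list l))) by (intros i; now rewrite entry_code_list).
  constructor; [easy|]. intros b Hin.
  rewrite (eval_ext _ (fun i => nth i l 0)) by (intros i; now rewrite entry_code_list).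
  auto.
Qed.

Lemma derivable_least P (X : nat -> Prop) :
  (forall s, Forall (clause_holds X s) P) -> forall x, derivable P x -> X x.
Proof.
  intros HX x. induction 1 as [c s Hc _ IH].
  specialize (HX (entry s)). rewrite Forall_forall in HX.
  exact (proj1 (clause_holds_iff X _ c) (HX c Hc) IH).
Qed.

(** * The predicate symbols and the clauses defining them *)

Inductive sym :=
| SNeq | SMem | SScoped | SPat | SKind | SOpKind | SDiff | SEvalOp | SSubst
| SBasic | SFrame | SRed | SErr | SSteps | SChecker | SGenerator | SIllTyped.

Definition code_sym (p : sym) : nat :=
  match p with
  | SNeq => 0 | SMem => 1 | SScoped => 2 | SPat => 3 | SKind => 4 | SOpKind => 5
  | SDiff => 6 | SEvalOp => 7 | SSubst => 8 | SBasic => 9 | SFrame => 10 | SRed => 11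
  | SErr => 12 | SSteps => 13 | SChecker => 14 | SGenerator => 15 | SIllTyped => 16
  end.

Lemma code_sym_inj p q : code_sym p = code_sym q -> p = q.
Proof. destruct p, q; easy. Qed.

(** Every predicate is given four arguments; unused ones are 0.  Only [SIllTyped] takes
    the code of a pair, which [Cantor.of_nat] splits into four arguments as well. *)
Definition fact (p : sym) (a b c d : nat) : nat :=
  Cantor.to_nat (code_sym p, Cantor.to_nat (a, Cantor.to_nat (b, Cantor.to_nat (c, d)))).

Definition atom (p : sym) (a b c d : term) : term :=
  Pair (Cst (code_sym p)) (Pair a (Pair b (Pair c d))).

Local Notation "# i" := (Var i) (at level 1, format "# i").
Local Notation "h :- b" := (Clause h b) (at level 70).

Local Notation tInt z := (Pair (Cst 0) z).
Local Notation tBool b := (Pair (Cst 1) b).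
Local Notation tFun x e := (Pair (Cst 2) (Pair x e)).
Local Notation tVar x := (Pair (Cst 3) x).
Local Notation tApp e1 e2 := (Pair (Cst 4) (Pair e1 e2)).
Local Notation tOp o e1 e2 := (Pair (Cst 5) (Pair o (Pair e1 e2))).
Local Notation tIf e1 e2 e3 := (Pair (Cst 6) (Pair e1 (Pair e2 e3))).
Local Notation tIs e p := (Pair (Cst 7) (Pair e p)).
Local Notation tPickI := (Pair (Cst 8) (Cst 0)).
Local Notation tPickB := (Pair (Cst 9) (Cst 0)).
Local Notation tError := (Pair (Cst 10) (Cst 0)).

Local Notation aNeq x y := (atom SNeq x y (Cst 0) (Cst 0)).
Local Notation aMem x l := (atom SMem x l (Cst 0) (Cst 0)).
Local Notation aScoped l e := (atom SScoped l e (Cst 0) (Cst 0)).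
Local Notation aPat p := (atom SPat p (Cst 0) (Cst 0) (Cst 0)).
Local Notation aKind v k := (atom SKind v k (Cst 0) (Cst 0)).
Local Notation aOpKind o k := (atom SOpKind o k (Cst 0) (Cst 0)).
Local Notation aDiff z p q := (atom SDiff z p q (Cst 0)).
Local Notation aEvalOp o v1 v2 r := (atom SEvalOp o v1 v2 r).
Local Notation aSubst x v e e' := (atom SSubst x v e e').
Local Notation aBasic e e' := (atom SBasic e e' (Cst 0) (Cst 0)).
Local Notation aFrame a x y b := (atom SFrame a x y b).
Local Notation aRed e e' := (atom SRed e e' (Cst 0) (Cst 0)).
Local Notation aErr e := (atom SErr e (Cst 0) (Cst 0) (Cst 0)).
Local Notation aSteps e e' := (atom SSteps e e' (Cst 0) (Cst 0)).
Local Notation aChecker t e k c := (atom SChecker t e k c).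
Local Notation aGenerator t g := (atom SGenerator t g (Cst 0) (Cst 0)).

(** Inequality without negation: one of the numbers is the other plus a successor. *)
Definition neq_clauses : list clause :=
  [ aNeq #0 (Add #0 (Suc #1)) :- [];
    aNeq (Add #0 (Suc #1)) #0 :- [] ].

(** These clauses also recognise which numbers code expressions at all. The premises [aDiff],
    [aOpKind] and [aPat] merely certify that a field codes an integer, an operator or a pattern. *)
Definition scoped_clauses : list clause :=
  [ aMem #0 (Suc (Pair #0 #1)) :- [];
    aMem #0 (Suc (Pair #1 #2)) :- [aMem #0 #2];
    aPat (Cst 0) :- [];
    aPat (Cst 1) :- [];
    aPat (Cst 2) :- [];
    aScoped #0 (tInt #1) :- [aDiff #1 #2 #3];
    aScoped #0 (tBool (Cst 0)) :- [];
    aScoped #0 (tBool (Cst 1)) :- [];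
    aScoped #0 (tFun #1 #2) :- [aScoped (Suc (Pair #1 #0)) #2];
    aScoped #0 (tVar #1) :- [aMem #1 #0];
    aScoped #0 (tApp #1 #2) :- [aScoped #0 #1; aScoped #0 #2];
    aScoped #0 (tOp #1 #2 #3) :- [aOpKind #1 #4; aScoped #0 #2; aScoped #0 #3];
    aScoped #0 (tIf #1 #2 #3) :- [aScoped #0 #1; aScoped #0 #2; aScoped #0 #3];
    aScoped #0 (tIs #1 #2) :- [aScoped #0 #1; aPat #2];
    aScoped #0 tPickI :- [];
    aScoped #0 tPickB :- [];
    aScoped #0 tError :- [] ].

(** Integers are handled as differences of naturals, so addition, subtraction and order need only
    [Add], without cases on signs; for [Less] both differences share their subtrahend. The two cases
    of [aDiff] are the even codes (nonnegative integers) and the odd codes (negative ones). An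
    operation fails when an operand's kind differs from the kind its operator requires. *)
Definition op_clauses : list clause :=
  [ aKind (tInt #0) (Cst 0) :- [];
    aKind (tBool #0) (Cst 1) :- [];
    aKind (tFun #0 #1) (Cst 2) :- [];
    aOpKind (Cst 0) (Cst 0) :- [];
    aOpKind (Cst 1) (Cst 0) :- [];
    aOpKind (Cst 2) (Cst 0) :- [];
    aOpKind (Cst 3) (Cst 0) :- [];
    aOpKind (Cst 4) (Cst 1) :- [];
    aOpKind (Cst 5) (Cst 1) :- [];
    aOpKind (Cst 6) (Cst 1) :- [];
    aDiff (Add #0 #0) (Add #1 #0) #1 :- [];
    aDiff (Suc (Add #0 #0)) #1 (Add #1 (Suc #0)) :- [];
    aEvalOp (Cst 0) (tInt #0) (tInt #1) (tInt #2) :-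
      [aDiff #0 #3 #4; aDiff #1 #5 #6; aDiff #2 (Add #3 #5) (Add #4 #6)];
    aEvalOp (Cst 1) (tInt #0) (tInt #1) (tInt #2) :-
      [aDiff #0 #3 #4; aDiff #1 #5 #6; aDiff #2 (Add #3 #6) (Add #4 #5)];
    aEvalOp (Cst 2) (tInt #0) (tInt #1) (tBool (Cst 1)) :-
      [aDiff #0 #2 #3; aDiff #1 (Add #2 (Suc #4)) #3];
    aEvalOp (Cst 2) (tInt #0) (tInt #1) (tBool (Cst 0)) :-
      [aDiff #0 (Add #2 #4) #3; aDiff #1 #2 #3];
    aEvalOp (Cst 3) (tInt #0) (tInt #0) (tBool (Cst 1)) :- [];
    aEvalOp (Cst 3) (tInt #0) (tInt #1) (tBool (Cst 0)) :- [aNeq #0 #1];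
    aEvalOp (Cst 4) (tBool (Cst 0)) (tBool #0) (tBool (Cst 0)) :- [];
    aEvalOp (Cst 4) (tBool (Cst 1)) (tBool #0) (tBool #0) :- [];
    aEvalOp (Cst 5) (tBool (Cst 0)) (tBool #0) (tBool #0) :- [];
    aEvalOp (Cst 5) (tBool (Cst 1)) (tBool #0) (tBool (Cst 1)) :- [];
    aEvalOp (Cst 6) (tBool (Cst 0)) (tBool #0) (tBool #0) :- [];
    aEvalOp (Cst 6) (tBool (Cst 1)) (tBool (Cst 0)) (tBool (Cst 1)) :- [];
    aEvalOp (Cst 6) (tBool (Cst 1)) (tBool (Cst 1)) (tBool (Cst 0)) :- [];
    aEvalOp #0 #1 #2 tError :- [aKind #1 #3; aOpKind #0 #4; aNeq #3 #4];
    aEvalOp #0 #1 #2 tError :- [aKind #2 #3; aOpKind #0 #4; aNeq #3 #4] ].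

Definition subst_clauses : list clause :=
  [ aSubst #0 #1 (tInt #2) (tInt #2) :- [];
    aSubst #0 #1 (tBool #2) (tBool #2) :- [];
    aSubst #0 #1 (tFun #0 #2) (tFun #0 #2) :- [];
    aSubst #0 #1 (tFun #2 #3) (tFun #2 #4) :- [aNeq #2 #0; aSubst #0 #1 #3 #4];
    aSubst #0 #1 (tVar #0) #1 :- [];
    aSubst #0 #1 (tVar #2) (tVar #2) :- [aNeq #2 #0];
    aSubst #0 #1 (tApp #2 #3) (tApp #4 #5) :- [aSubst #0 #1 #2 #4; aSubst #0 #1 #3 #5];
    aSubst #0 #1 (tOp #2 #3 #4) (tOp #2 #5 #6) :-
      [aSubst #0 #1 #3 #5; aSubst #0 #1 #4 #6];
    aSubst #0 #1 (tIf #2 #3 #4) (tIf #5 #6 #7) :-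
      [aSubst #0 #1 #2 #5; aSubst #0 #1 #3 #6; aSubst #0 #1 #4 #7];
    aSubst #0 #1 (tIs #2 #3) (tIs #4 #3) :- [aSubst #0 #1 #2 #4];
    aSubst #0 #1 tPickI tPickI :- [];
    aSubst #0 #1 tPickB tPickB :- [];
    aSubst #0 #1 tError tError :- [] ].

Definition basic_clauses : list clause :=
  [ aBasic (tOp #0 #1 #2) #3 :- [aKind #1 #4; aKind #2 #5; aEvalOp #0 #1 #2 #3];
    aBasic (tApp (tFun #0 #1) #2) #3 :- [aKind #2 #4; aSubst #0 #2 #1 #3];
    aBasic (tApp #0 #1) tError :- [aKind #0 #2; aKind #1 #3; aNeq #2 (Cst 2)];
    aBasic (tIf (tBool (Cst 1)) #0 #1) #0 :- [];
    aBasic (tIf (tBool (Cst 0)) #0 #1) #1 :- [];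
    aBasic (tIf #0 #1 #2) tError :- [aKind #0 #3; aNeq #3 (Cst 1)];
    aBasic tPickI (tInt #0) :- [aDiff #0 #1 #2];
    aBasic tPickB (tBool (Cst 0)) :- [];
    aBasic tPickB (tBool (Cst 1)) :- [];
    aBasic (tIs #0 #1) (tBool (Cst 1)) :- [aKind #0 #1];
    aBasic (tIs #0 #1) (tBool (Cst 0)) :- [aKind #0 #2; aNeq #2 #1] ].

(** [aFrame a x y b] stands for a = F[[x]] and b = F[[y]], where F is a reduction
    context of depth one. *)
Definition step_clauses : list clause :=
  [ aFrame (tApp #0 #1) #0 #2 (tApp #2 #1) :- [];
    aFrame (tApp #1 #0) #0 #2 (tApp #1 #2) :- [];
    aFrame (tOp #3 #0 #1) #0 #2 (tOp #3 #2 #1) :- [];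
    aFrame (tOp #3 #1 #0) #0 #2 (tOp #3 #1 #2) :- [aKind #1 #4];
    aFrame (tIf #0 #1 #3) #0 #2 (tIf #2 #1 #3) :- [];
    aFrame (tIs #0 #1) #0 #2 (tIs #2 #1) :- [];
    aRed #0 #1 :- [aBasic #0 #1];
    aRed #0 #3 :- [aFrame #0 #1 #2 #3; aRed #1 #2];
    aErr #0 :- [aRed #0 tError];
    aErr #0 :- [aFrame #0 tError #1 #2];
    aErr #0 :- [aFrame #0 #1 #2 #3; aErr #1];
    aSteps #0 #0 :- [];
    aSteps #0 #2 :- [aRed #0 #1; aSteps #1 #2];
    aSteps #0 #1 :- [aErr #0; aSteps tError #1] ].

(** In [aChecker t e k c], [k] is the largest free variable of [e], or 0: [S k] is then the
    [fresh] variable, and also the largest one at the recursive call. *)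
Definition checker_clauses : list clause :=
  [ aChecker (Pair (Cst 0) (Cst 0)) #0 #1 (tIs #0 (Cst 0)) :- [];
    aChecker (Pair (Cst 1) (Cst 0)) #0 #1 (tIs #0 (Cst 1)) :- [];
    aChecker (Pair (Cst 2) (Pair #0 #1)) #2 #3
      (tIf (tIs #2 (Cst 2)) (tApp (tFun (Suc #3) #5) #4) (tBool (Cst 0))) :-
      [aGenerator #0 #4; aChecker #1 (tApp #2 (tVar (Suc #3))) (Suc #3) #5];
    aGenerator (Pair (Cst 0) (Cst 0)) tPickI :- [];
    aGenerator (Pair (Cst 1) (Cst 0)) tPickB :- [];
    aGenerator (Pair (Cst 2) (Pair #0 #1))
      (tFun (Cst gen_param) (tIf tPickB (tIf #2 #3 tError) #3)) :-
      [aChecker #0 (tVar (Cst gen_param)) (Cst gen_param) #2; aGenerator #1 #3] ].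

(** One clause for each way to violate [TC]. [Cst 0] is the empty scope in [aScoped], and in
    [aChecker] the variable bound that goes with a closed expression. *)
Definition ill_typed_clauses : list clause :=
  [ Pair (Cst (code_sym SIllTyped)) (Pair #0 #1) :-
      [aScoped (Cst 0) #0; aChecker #1 #0 (Cst 0) #2; aSteps #2 tError];
    Pair (Cst (code_sym SIllTyped)) (Pair #0 #1) :-
      [aScoped (Cst 0) #0; aChecker #1 #0 (Cst 0) #2; aSteps #2 #3; aKind #3 #4;
       aNeq #3 (tBool (Cst 1))] ].

Definition program : list clause :=
  neq_clauses ++ scoped_clauses ++ op_clauses ++ subst_clauses ++ basic_clauses ++
  step_clauses ++ checker_clauses ++ ill_typed_clauses.

(** * Soundness of the clauses *)

(** Unlike in [code_list], the empty list must be told apart from [[0]]: the successor prevents both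
    from having code 0. *)
Definition code_scope (l : list var) : nat :=
  fold_right (fun x c => S (Cantor.to_nat (x, c))) 0 l.

(** Numbered like the patterns in [code_pat], so that a pattern test is an equality of kinds;
    non-values get the junk value 2. *)
Definition kind (e : expr) : nat :=
  match e with EInt _ => 0 | EBool _ => 1 | _ => 2 end.

Definition op_kind (o : op) : nat :=
  match o with And | Or | Xor => 1 | _ => 0 end.

Lemma matches_kind v p : is_value v -> matches v p = (kind v =? code_pat p).
Proof. destruct v, p; easy. Qed.

(** Most meanings assume that the input arguments are codes, since the clauses do not test them, and
    conclude that the outputs are codes, so that validity propagates along a reduction. It starts
    from [SScoped], which produces the expression, and from [SChecker] and [SGenerator], which
    produce the type. *)
Definition meaning (p : sym) (a b c d : nat) : Prop :=
  match p with
  | SNeq => a <> b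
  | SMem => forall l, b = code_scope l -> In a l
  | SScoped => forall l, a = code_scope l -> exists e, b = code_expr e /\ incl (fv e) l
  | SPat => exists p, a = code_pat p
  | SKind => forall e, a = code_expr e -> is_value e /\ kind e = b
  | SOpKind => exists o, a = code_op o /\ op_kind o = b
  | SDiff => exists z, a = code_Z z /\ z = (Z.of_nat b - Z.of_nat c)%Z
  | SEvalOp => forall o e1 e2, a = code_op o -> b = code_expr e1 -> c = code_expr e2 ->
      d = code_expr (eval_op o e1 e2)
  | SSubst => forall v e, b = code_expr v -> c = code_expr e ->
      d = code_expr (subst a v e)
  | SBasic => forall r, a = code_expr r -> exists e, b = code_expr e /\ basic r e
  | SFrame => forall e, a = code_expr e -> exists R x,
      R <> CHole /\ b = code_expr x /\ e = plug R x /\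
      forall y, c = code_expr y -> d = code_expr (plug R y)
  | SRed => forall e, a = code_expr e -> exists R r r',
      basic r r' /\ e = plug R r /\ b = code_expr (plug R r')
  | SErr => forall e, a = code_expr e -> step e EError
  | SSteps => forall e, a = code_expr e -> exists e', b = code_expr e' /\ steps e e'
  | SChecker => exists t, a = code_ty t /\
      forall e, b = code_expr e -> c = list_max (fv e) -> d = code_expr (checker t e)
  | SGenerator => exists t, a = code_ty t /\ b = code_expr (generator t)
  | SIllTyped =>
      exists p, code_pair p = Cantor.to_nat (a, Cantor.to_nat (b, Cantor.to_nat (c, d))) /\
        ~ TC_pairs p
  end.

Definition true_fact (x : nat) : Prop :=
  forall p a b c d, x = fact p a b c d -> meaning p a b c d.

Ltac inj :=
  repeat match goal with
    | H : Cantor.to_nat _ = Cantor.to_nat _ |- _ =>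
        apply Cantor.to_nat_inj, pair_equal_spec in H as [? ?]
    end.

Lemma true_fact_atom s p a b c d :
  true_fact (eval s (atom p a b c d)) <->
  meaning p (eval s a) (eval s b) (eval s c) (eval s d).
Proof.
  unfold true_fact, atom, fact. cbn [eval]. split; [auto|].
  intros H q a' b' c' d' E. inj. apply code_sym_inj in H0 as <-. congruence.
Qed.

Ltac decode :=
  repeat first
    [ progress subst
    | match goal with
      | H : ?x = ?x |- _ => clear H
      | H : Cantor.to_nat _ = Cantor.to_nat _ |- _ =>
          apply Cantor.to_nat_inj, pair_equal_spec in H as [? ?]
      | H : Cantor.to_nat _ = code_expr ?e |- _ =>
          is_var e; destruct e; cbn [code_expr] in H; inj; try discriminate
      | H : Cantor.to_nat (10, 0) = code_expr _ |- _ =>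
          apply (code_expr_inj EError) in H
      | H : code_expr ?e = Cantor.to_nat _ |- _ => symmetry in H
      | H : code_expr _ = code_expr _ |- _ => apply code_expr_inj in H
      | H : code_op _ = code_op _ |- _ => apply code_op_inj in H
      | H : code_Z _ = code_Z _ |- _ => apply code_Z_inj in H
      | H : code_pat _ = code_pat _ |- _ => apply code_pat_inj in H
      | H : forall e, code_expr ?e0 = code_expr e -> _ |- _ => specialize (H e0 eq_refl)
      | H : forall v e, code_expr ?v0 = code_expr v -> code_expr ?e0 = code_expr e -> _ |- _ =>
          specialize (H v0 e0 eq_refl eq_refl)
      | H : forall o v1 v2, code_op ?o0 = code_op o -> code_expr ?e1 = code_expr v1 ->
              code_expr ?e2 = code_expr v2 -> _ |- _ =>
          specialize (H o0 e1 e2 eq_refl eq_refl eq_refl)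
      | H : exists _, _ |- _ => destruct H
      | H : _ /\ _ |- _ => destruct H
      | H : ?n = code_op ?o |- _ =>
          match n with 0 => idtac | S _ => idtac end;
          is_var o; destruct o; try discriminate H; clear H
      | H : ?n = Nat.b2n ?b |- _ =>
          match n with 0 => idtac | S _ => idtac end;
          is_var b; destruct b; try discriminate H; clear H
      end ].

Ltac clause_cases :=
  intros s; repeat (apply Forall_cons || apply Forall_nil);
  unfold clause_holds; cbn [body head fold_right];
  rewrite ?true_fact_atom; cbn [eval meaning code_sym];
  repeat match goal with
    | |- context [s ?i] => let x := fresh "x" in generalize (s i); intro x
    end; clear s.

Lemma neq_sound : forall s, Forall (clause_holds true_fact s) neq_clauses.
Proof. clause_cases; lia. Qed.

Lemma scoped_sound : forall s, Forall (clause_holds true_fact s) scoped_clauses.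
Proof.
  clause_cases; intros;
    repeat match goal with
      | H : forall l, ?x = code_scope l -> exists e, _, E : ?x = code_scope _ |- _ =>
          destruct (H _ E) as [? [-> ?]]; clear H
      end.
  - destruct l as [|y l]; [discriminate|]. cbn in H. injection H as H. decode. now left.
  - destruct l as [|y l]; [discriminate|]. cbn in H0. injection H0 as H0. decode.
    right. now apply H.
  - now exists PInt.
  - now exists PBool.
  - now exists PFun.
  - destruct H as [z [-> _]]. exists (EInt z). split; [easy|]. apply incl_nil_l.
  - exists (EBool false). split; [easy|]. apply incl_nil_l.
  - exists (EBool true). split; [easy|]. apply incl_nil_l.
  - destruct (H (x :: l)) as [e [-> He]]; [now subst|].
    exists (EFun x e). split; [easy|]. cbn [fv]. intros y Hy.
    apply in_remove in Hy as [Hy Hne]. destruct (He y Hy); [congruence | easy].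
  - exists (EVar x0). split; [easy|]. intros y [<-|[]]. auto.
  - eexists (EApp _ _). split; [reflexivity|]. now apply incl_app.
  - destruct H as [o [-> _]]. eexists (EOp o _ _). split; [reflexivity|]. now apply incl_app.
  - eexists (EIf _ _ _). split; [reflexivity|]. now repeat apply incl_app.
  - destruct H0 as [p ->]. eexists (EIs _ p). now split.
  - exists EPickI. split; [easy|]. apply incl_nil_l.
  - exists EPickB. split; [easy|]. apply incl_nil_l.
  - exists EError. split; [easy|]. apply incl_nil_l.
Qed.

Lemma code_Z_nat n : code_Z (Z.of_nat n) = n + n.
Proof. unfold code_Z. destruct (Z.ltb_spec (Z.of_nat n) 0); lia. Qed.

Lemma code_Z_neg n : code_Z (- Z.of_nat (S n)) = S (n + n).
Proof. unfold code_Z. destruct (Z.ltb_spec (- Z.of_nat (S n)) 0); lia. Qed.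

Lemma eval_op_kind_l o v1 v2 :
  is_value v1 -> kind v1 <> op_kind o -> eval_op o v1 v2 = EError.
Proof. destruct o, v1; easy. Qed.

Lemma eval_op_kind_r o v1 v2 :
  is_value v2 -> kind v2 <> op_kind o -> eval_op o v1 v2 = EError.
Proof. destruct o, v1, v2; easy. Qed.

Lemma op_sound : forall s, Forall (clause_holds true_fact s) op_clauses.
Proof.
  clause_cases; intros; decode; try easy.
  - now exists Plus.
  - now exists Minus.
  - now exists Less.
  - now exists Equal.
  - now exists And.
  - now exists Or.
  - now exists Xor.
  - exists (Z.of_nat x). rewrite code_Z_nat. lia.
  - exists (- Z.of_nat (S x))%Z. rewrite code_Z_neg. lia.
  - cbn. do 3 f_equal. lia.
  - cbn. do 3 f_equal. lia.
  - cbn. match goal with |- context [(?a <? ?b)%Z] => destruct (Z.ltb_spec a b) end;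
      [easy | lia].
  - cbn. match goal with |- context [(?a <? ?b)%Z] => destruct (Z.ltb_spec a b) end;
      [lia | easy].
  - cbn. now rewrite Z.eqb_refl.
  - cbn. destruct (Z.eqb_spec n0 n); [congruence | easy].
  - now rewrite eval_op_kind_l.
  - now rewrite eval_op_kind_r.
Qed.

Lemma subst_sound : forall s, Forall (clause_holds true_fact s) subst_clauses.
Proof.
  clause_cases; intros; decode; try easy; cbn [subst].
  - now rewrite Nat.eqb_refl.
  - now rewrite (proj2 (Nat.eqb_neq _ _)).
  - now rewrite Nat.eqb_refl.
  - now rewrite (proj2 (Nat.eqb_neq _ _)).
Qed.

Lemma basic_sound : forall s, Forall (clause_holds true_fact s) basic_clauses.
Proof.
  clause_cases; intros; decode; try easy.
  - eexists. split; [reflexivity|]. now constructor.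
  - eexists. split; [reflexivity|]. now constructor.
  - exists EError. split; [easy|]. constructor; [easy..|]. now destruct r1.
  - eexists. split; [reflexivity|]. constructor.
  - eexists. split; [reflexivity|]. constructor.
  - exists EError. split; [easy|]. constructor; [easy|]. now destruct r1.
  - eexists (EInt _). split; [reflexivity|]. constructor.
  - exists (EBool false). split; [easy|]. constructor.
  - exists (EBool true). split; [easy|]. constructor.
  - exists (EBool (matches r p)).
    split; [|now constructor].
    rewrite matches_kind by easy. now rewrite (proj2 (Nat.eqb_eq _ _)).
  - exists (EBool (matches r p)).
    split; [|now constructor].
    rewrite matches_kind by easy. now rewrite (proj2 (Nat.eqb_neq _ _)).
Qed.

(** Contexts compose: clauses build a context frame by frame, whereas the step rules use a whole
    context at once. *)
Lemma plug_plug R1 R2 : exists R, forall e, plug R e = plug R1 (plug R2 e).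
Proof.
  induction R1 as [|R1 [R IH] e2|e1 R1 [R IH]|o R1 [R IH] e2|o v Hv R1 [R IH]
    |R1 [R IH] e2 e3|R1 [R IH] p].
  - now exists R2.
  - exists (CAppL R e2). intros. cbn. now rewrite IH.
  - exists (CAppR e1 R). intros. cbn. now rewrite IH.
  - exists (COpL o R e2). intros. cbn. now rewrite IH.
  - exists (COpR o v Hv R). intros. cbn. now rewrite IH.
  - exists (CIf R e2 e3). intros. cbn. now rewrite IH.
  - exists (CIs R p). intros. cbn. now rewrite IH.
Qed.

Lemma step_sound : forall s, Forall (clause_holds true_fact s) step_clauses.
Proof.
  clause_cases; intros; decode; try easy.
  - exists (CAppL CHole e2), e1. repeat split; try easy. now intros y ->.
  - exists (CAppR e1 CHole), e2. repeat split; try easy. now intros y ->.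
  - exists (COpL o CHole e2), e1. repeat split; try easy. now intros y ->.
  - exists (COpR o e1 ltac:(assumption) CHole), e2. repeat split; try easy. now intros y ->.
  - exists (CIf CHole e2 e3), e1. repeat split; try easy. now intros y ->.
  - exists (CIs CHole p), e. repeat split; try easy. now intros y ->.
  - exists CHole, e, x. auto.
  - destruct (plug_plug x x0) as [R HR]. exists R, x4, x5. now rewrite !HR.
  (* The ERROR reached is itself the context filled with the contractum, so this is an instance of
     [step_red]. *)
  - match goal with H : EError = _ |- _ => rewrite H end. now constructor.
  - now constructor.
  - now constructor.
  - exists e. split; [easy | apply rt_refl].
  - exists x0. split; [easy|]. eapply rt_trans; [apply rt_step|eassumption].
    now constructor.
  - match goal with
    | H : forall e, Cantor.to_nat _ = code_expr e -> _ |- _ =>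
        destruct (H EError eq_refl) as [e' [-> He]]
    end.
    exists e'. split; [easy|]. eapply rt_trans; [apply rt_step|]; eassumption.
Qed.

Lemma list_max_fv_app e k : list_max (fv e) = k -> list_max (fv (EApp e (EVar (S k)))) = S k.
Proof. intros <-. cbn [fv]. rewrite list_max_app. cbn. lia. Qed.

Lemma checker_sound : forall s, Forall (clause_holds true_fact s) checker_clauses.
Proof.
  clause_cases.
  - exists TInt. split; [easy|]. now intros e ->.
  - exists TBool. split; [easy|]. now intros e ->.
  - intros [t1 [-> ->]] [t2 [-> H]]. exists (TArr t1 t2). split; [easy|]. intros e -> ->.
    rewrite (H (EApp e (EVar (fresh e)))).
    + reflexivity.
    + reflexivity.
    + symmetry. now apply list_max_fv_app.
  - now exists TInt.
  - now exists TBool.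
  - intros [t1 [-> H]] [t2 [-> ->]]. exists (TArr t1 t2). split; [easy|].
    rewrite (H (EVar gen_param)) by easy. reflexivity.
Qed.

Lemma ill_typed_sound : forall s, Forall (clause_holds true_fact s) ill_typed_clauses.
Proof.
  intros s; repeat (apply Forall_cons || apply Forall_nil);
    unfold clause_holds; cbn [body head fold_right]; rewrite !true_fact_atom;
    cbn [eval meaning code_sym]; intros H [T [HT Hc]];
    destruct (H [] eq_refl) as [E [HE Hfv]]; clear H.
  (* The scope 0 is that of the empty list, so the expression is closed; its [list_max] is then 0,
     the bound passed in the clause. *)
  all: apply incl_l_nil in Hfv; specialize (Hc E HE); rewrite Hfv in Hc;
    specialize (Hc eq_refl).
  - intros Hs q a b c d Eq. unfold fact in Eq. inj.
    apply (code_sym_inj SIllTyped) in H as <-. cbn [meaning].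
    exists (exist _ E Hfv, T). split.
    + unfold code_pair. cbn [fst snd proj1_sig]. congruence.
    + intros [H _]. apply H. destruct (Hs _ Hc) as [e [He Hsteps]].
      now apply (code_expr_inj EError) in He as <-.
  - intros Hs Hk Hne q a b c d Eq. unfold fact in Eq. inj.
    apply (code_sym_inj SIllTyped) in H as <-. cbn [meaning].
    exists (exist _ E Hfv, T). split.
    + unfold code_pair. cbn [fst snd proj1_sig]. congruence.
    + intros [_ H]. destruct (Hs _ Hc) as [e [He Hsteps]].
      destruct (Hk _ He) as [Hv _]. apply (H e Hv) in Hsteps. now subst.
Qed.

Lemma program_sound x : derivable program x -> true_fact x.
Proof.
  apply derivable_least. intros s. unfold program. rewrite !Forall_app.
  auto 10 using neq_sound, scoped_sound, op_sound, subst_sound, basic_sound, step_sound,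
    checker_sound, ill_typed_sound.
Qed.

(** * Completeness of the clauses *)

Ltac in_program := unfold program; rewrite !in_app_iff; cbn; tauto.

(** Applies the clause at position [k] of [l]. Variables occurring only in premises stay open until
    those premises are proved. *)
Ltac by_clause l k :=
  let H := fresh "Hclause" in
  pose proof (derivable_intro program (nth k l (Clause (Cst 0) []))
    ltac:(in_program)) as H;
  cbn -[program Nat.add] in H; eapply H; clear H.

Lemma neq_complete x y : x <> y -> derivable program (fact SNeq x y 0 0).
Proof.
  intros H. destruct (Nat.lt_total x y) as [Hl|[Hl|Hl]]; [|easy|].
  - replace y with (x + S (y - x - 1)) by lia. by_clause neq_clauses 0.
  - replace x with (y + S (x - y - 1)) by lia. by_clause neq_clauses 1.
Qed.

Lemma mem_complete x l : In x l -> derivable program (fact SMem x (code_scope l) 0 0).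
Proof.
  induction l as [|y l IH]; intros []; cbn [code_scope fold_right].
  - subst. by_clause scoped_clauses 0.
  - by_clause scoped_clauses 1. now apply IH.
Qed.

Lemma op_kind_complete o : derivable program (fact SOpKind (code_op o) (op_kind o) 0 0).
Proof.
  destruct o; [by_clause op_clauses 3 | by_clause op_clauses 4 | by_clause op_clauses 5
    | by_clause op_clauses 6 | by_clause op_clauses 7 | by_clause op_clauses 8
    | by_clause op_clauses 9].
Qed.

Lemma kind_complete v :
  is_value v -> derivable program (fact SKind (code_expr v) (kind v) 0 0).
Proof.
  destruct v; try easy; intros _; cbn [code_expr];
    [by_clause op_clauses 0 | by_clause op_clauses 1 | by_clause op_clauses 2].
Qed.

Lemma diff_complete p q :
  derivable program (fact SDiff (code_Z (Z.of_nat p - Z.of_nat q)) p q 0).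
Proof.
  destruct (Nat.le_gt_cases q p).
  - replace (Z.of_nat p - Z.of_nat q)%Z with (Z.of_nat (p - q)) by lia.
    (* Only the argument [p] of the fact is rewritten, into the sum of the clause head, which
       unification would not find. *)
    rewrite code_Z_nat. replace p with (q + (p - q)) at 3 by lia. by_clause op_clauses 10.
  - replace (Z.of_nat p - Z.of_nat q)%Z with (- Z.of_nat (S (q - p - 1)))%Z by lia.
    rewrite code_Z_neg. replace q with (p + S (q - p - 1)) at 3 by lia.
    by_clause op_clauses 11.
Qed.

Lemma pat_complete p : derivable program (fact SPat (code_pat p) 0 0 0).
Proof.
  destruct p;
    [by_clause scoped_clauses 2 | by_clause scoped_clauses 3 | by_clause scoped_clauses 4].
Qed.

Lemma Z_diff z : exists p q, z = (Z.of_nat p - Z.of_nat q)%Z.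
Proof. exists (Z.to_nat z), (Z.to_nat (- z)). lia. Qed.

Lemma scoped_complete e l :
  incl (fv e) l -> derivable program (fact SScoped (code_scope l) (code_expr e) 0 0).
Proof.
  revert l.
  induction e as [n|b|x e IH|x|e1 IH1 e2 IH2|o e1 IH1 e2 IH2|e1 IH1 e2 IH2 e3 IH3|e IH p
    | | |]; cbn [fv code_expr]; intros l Hl;
    repeat match goal with H : incl (_ ++ _) _ |- _ => apply incl_app_inv in H as [? ?] end.
  - destruct (Z_diff n) as [p [q ->]]. by_clause scoped_clauses 5. apply diff_complete.
  - destruct b; [by_clause scoped_clauses 7 | by_clause scoped_clauses 6].
  - by_clause scoped_clauses 8. apply (IH (x :: l)). intros y Hy.
    destruct (Nat.eq_dec y x) as [->|]; [now left|]. right. apply Hl. now apply in_in_remove.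
  - by_clause scoped_clauses 9. apply mem_complete, Hl. now left.
  - by_clause scoped_clauses 10; [now apply IH1 | now apply IH2].
  - by_clause scoped_clauses 11; [apply op_kind_complete | now apply IH1 | now apply IH2].
  - by_clause scoped_clauses 12; [now apply IH1 | now apply IH2 | now apply IH3].
  - by_clause scoped_clauses 13; [now apply IH | apply pat_complete].
  - by_clause scoped_clauses 14.
  - by_clause scoped_clauses 15.
  - by_clause scoped_clauses 16.
Qed.

Lemma eval_op_complete o v1 v2 :
  is_value v1 -> is_value v2 ->
  derivable program
    (fact SEvalOp (code_op o) (code_expr v1) (code_expr v2) (code_expr (eval_op o v1 v2))).
Proof.
  intros H1 H2.
  destruct (Nat.eq_dec (kind v1) (op_kind o)) as [E1|E1].
  2: { rewrite eval_op_kind_l by easy.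
       by_clause op_clauses 25;
         [now apply kind_complete | apply op_kind_complete | now apply neq_complete]. }
  destruct (Nat.eq_dec (kind v2) (op_kind o)) as [E2|E2].
  2: { rewrite eval_op_kind_r by easy.
       by_clause op_clauses 26;
         [now apply kind_complete | apply op_kind_complete | now apply neq_complete]. }
  destruct o, v1 as [z1|b1|?|?|?|?|?|?| | |]; try easy;
    destruct v2 as [z2|b2|?|?|?|?|?|?| | |]; try easy; cbn [eval_op code_op code_expr].
  - destruct (Z_diff z1) as [p [q ->]], (Z_diff z2) as [r [s ->]].
    by_clause op_clauses 12; [apply diff_complete | apply diff_complete |].
    replace (_ + _)%Z with (Z.of_nat (p + r) - Z.of_nat (q + s))%Z by lia.
    apply diff_complete.
  - destruct (Z_diff z1) as [p [q ->]], (Z_diff z2) as [r [s ->]].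
    by_clause op_clauses 13; [apply diff_complete | apply diff_complete |].
    replace (_ - _ - _)%Z with (Z.of_nat (p + s) - Z.of_nat (q + r))%Z by lia.
    apply diff_complete.
  - destruct (Z.ltb_spec z1 z2); cbn [Nat.b2n].
    (* The clause needs a common subtrahend: [q] is large enough for [z1 + q] and [z2 + q] both to
       be natural. *)
    + set (q := Z.to_nat (- Z.min z1 z2)).
      assert (z1 = Z.of_nat (Z.to_nat (z1 + Z.of_nat q)) - Z.of_nat q)%Z as -> by lia.
      set (p := Z.to_nat (z1 + Z.of_nat q)) in *.
      assert (z2 = Z.of_nat (p + S (Z.to_nat (z2 - (Z.of_nat p - Z.of_nat q) - 1)))
                   - Z.of_nat q)%Z as -> by lia.
      by_clause op_clauses 14; apply diff_complete.
    + set (q := Z.to_nat (- Z.min z1 z2)).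
      assert (z2 = Z.of_nat (Z.to_nat (z2 + Z.of_nat q)) - Z.of_nat q)%Z as -> by lia.
      set (p := Z.to_nat (z2 + Z.of_nat q)) in *.
      assert (z1 = Z.of_nat (p + Z.to_nat (z1 - (Z.of_nat p - Z.of_nat q)))
                   - Z.of_nat q)%Z as -> by lia.
      by_clause op_clauses 15; apply diff_complete.
  - destruct (Z.eqb_spec z1 z2) as [->|Hne]; cbn [Nat.b2n].
    + by_clause op_clauses 16.
    + by_clause op_clauses 17. apply neq_complete. now intros ?%code_Z_inj.
  - destruct b1; [by_clause op_clauses 19 | by_clause op_clauses 18].
  - destruct b1; [by_clause op_clauses 21 | by_clause op_clauses 20].
  - destruct b1; [|by_clause op_clauses 22].
    destruct b2; [by_clause op_clauses 24 | by_clause op_clauses 23].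
Qed.

Lemma subst_complete x v e :
  derivable program
    (fact SSubst x (code_expr v) (code_expr e) (code_expr (subst x v e))).
Proof.
  induction e as [n|b|y e IH|y|e1 IH1 e2 IH2|o e1 IH1 e2 IH2|e1 IH1 e2 IH2 e3 IH3|e IH p
    | | |]; cbn [subst code_expr].
  - by_clause subst_clauses 0.
  - by_clause subst_clauses 1.
  - destruct (Nat.eqb_spec y x) as [->|Hne].
    + by_clause subst_clauses 2.
    + by_clause subst_clauses 3; [now apply neq_complete | exact IH].
  - destruct (Nat.eqb_spec y x) as [->|Hne].
    + by_clause subst_clauses 4.
    + by_clause subst_clauses 5. now apply neq_complete.
  - by_clause subst_clauses 6; [exact IH1 | exact IH2].
  - by_clause subst_clauses 7; [exact IH1 | exact IH2].
  - by_clause subst_clauses 8; [exact IH1 | exact IH2 | exact IH3].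
  - by_clause subst_clauses 9. exact IH.
  - by_clause subst_clauses 10.
  - by_clause subst_clauses 11.
  - by_clause subst_clauses 12.
Qed.

Lemma basic_complete r e :
  basic r e -> derivable program (fact SBasic (code_expr r) (code_expr e) 0 0).
Proof.
  intros [o v1 v2 H1 H2|x e' v Hv|v v' Hv Hv' Hf|e1 e2|e1 e2|v e1 e2 Hv Hb|n|b|v p Hv];
    cbn [code_expr Nat.b2n].
  - by_clause basic_clauses 0;
      [now apply kind_complete | now apply kind_complete | now apply eval_op_complete].
  - by_clause basic_clauses 1; [now apply kind_complete | apply subst_complete].
  - by_clause basic_clauses 2; [now apply kind_complete | now apply kind_complete |].
    apply neq_complete. now destruct v.
  - by_clause basic_clauses 3.
  - by_clause basic_clauses 4.
  - by_clause basic_clauses 5; [now apply kind_complete|].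
    apply neq_complete. now destruct v.
  - destruct (Z_diff n) as [p [q ->]]. by_clause basic_clauses 6. apply diff_complete.
  - destruct b; [by_clause basic_clauses 8 | by_clause basic_clauses 7].
  - rewrite matches_kind by easy. destruct (Nat.eqb_spec (kind v) (code_pat p)) as [<-|Hne].
    + by_clause basic_clauses 9. now apply kind_complete.
    + by_clause basic_clauses 10; [now apply kind_complete | now apply neq_complete].
Qed.

(** Induction on contexts that treats all frames of depth one alike: the clauses of [SFrame] are
    matched with the constructors here once, and later inductions have only the hole and one generic
    frame. *)
Lemma ctx_frame_ind (Q : ctx -> Prop) :
  Q CHole ->
  (forall R1 R2,
     (forall x y, derivable program
        (fact SFrame (code_expr (plug R2 x)) (code_expr (plug R1 x))
           (code_expr (plug R1 y)) (code_expr (plug R2 y)))) ->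
     Q R1 -> Q R2) ->
  forall R, Q R.
Proof.
  intros Hhole Hframe R.
  induction R as [|R IH e2|e1 R IH|o R IH e2|o v Hv R IH|R IH e2 e3|R IH p];
    [exact Hhole | apply (Hframe R _); [|exact IH].. ];
    intros x y; cbn [plug code_expr].
  - by_clause step_clauses 0.
  - by_clause step_clauses 1.
  - by_clause step_clauses 2.
  - by_clause step_clauses 3. now apply kind_complete.
  - by_clause step_clauses 4.
  - by_clause step_clauses 5.
Qed.

Lemma red_complete R r e :
  basic r e ->
  derivable program (fact SRed (code_expr (plug R r)) (code_expr (plug R e)) 0 0).
Proof.
  intros H. induction R as [|R1 R2 HF IH] using ctx_frame_ind.
  - by_clause step_clauses 6. now apply basic_complete.
  - by_clause step_clauses 7; [apply HF | exact IH].
Qed.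

Lemma err_plug_complete R e :
  derivable program (fact SErr (code_expr e) 0 0 0) ->
  derivable program (fact SErr (code_expr (plug R e)) 0 0 0).
Proof.
  intros H. induction R as [|R1 R2 HF IH] using ctx_frame_ind; [exact H|].
  by_clause step_clauses 10; [apply HF with (y := e) | exact IH].
Qed.

Lemma err_error_complete R :
  R <> CHole -> derivable program (fact SErr (code_expr (plug R EError)) 0 0 0).
Proof.
  (* The disjunction lets the induction distinguish a frame directly around ERROR from a frame
     around a larger context, which propagates the error. *)
  enough (R = CHole \/ derivable program (fact SErr (code_expr (plug R EError)) 0 0 0))
    by tauto.
  induction R as [|R1 R2 HF [->|IH]] using ctx_frame_ind; [now left|right..].
  - by_clause step_clauses 9. apply (HF EError EError).
  - by_clause step_clauses 10; [apply HF with (y := EError) | exact IH].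
Qed.

(** The (Err) rules discard the context, so they give [SErr] rather than [SRed]. Their premise may
    be a reduction whose result happens to be ERROR, which is first turned into an [SErr] fact and
    then carried through the context. *)
Lemma step_complete e e' :
  step e e' ->
  derivable program (fact SRed (code_expr e) (code_expr e') 0 0) \/
  (e' = EError /\ derivable program (fact SErr (code_expr e) 0 0 0)).
Proof.
  intros H.
  induction H as [R r e H|R e H IH|R H]; [left; now apply red_complete | right; split..];
    [easy| |easy|now apply err_error_complete].
  apply err_plug_complete. destruct IH as [IH|[_ IH]]; [|exact IH].
  by_clause step_clauses 8. exact IH.
Qed.

Lemma steps_complete e e' :
  steps e e' -> derivable program (fact SSteps (code_expr e) (code_expr e') 0 0).
Proof.
  intros H. apply clos_rt_rt1n in H.
  induction H as [e|e1 e2 e3 H _ IH]; [by_clause step_clauses 11|].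
  apply step_complete in H as [H|[-> H]].
  - by_clause step_clauses 12; [exact H | exact IH].
  - by_clause step_clauses 13; [exact H | exact IH].
Qed.

(** Both halves are proved together because the two functions are mutually recursive; [e] is
    quantified inside since the recursive call extends it by an application. *)
Lemma checker_generator_complete t :
  (forall e, derivable program
     (fact SChecker (code_ty t) (code_expr e) (list_max (fv e)) (code_expr (checker t e)))) /\
  derivable program (fact SGenerator (code_ty t) (code_expr (generator t)) 0 0).
Proof.
  induction t as [| |t1 [IHc1 IHg1] t2 [IHc2 IHg2]];
    cbn [code_ty checker generator code_expr ELet Nat.b2n code_pat].
  - split; [intros e; by_clause checker_clauses 0 | by_clause checker_clauses 3].
  - split; [intros e; by_clause checker_clauses 1 | by_clause checker_clauses 4].
  - split; [intros e|].
    + by_clause checker_clauses 2; [exact IHg1|].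
      specialize (IHc2 (EApp e (EVar (fresh e)))).
      assert (E : list_max (fv (EApp e (EVar (fresh e)))) = fresh e)
        by now apply list_max_fv_app.
      rewrite E in IHc2. exact IHc2.
    + by_clause checker_clauses 5; [exact (IHc1 (EVar gen_param)) | exact IHg2].
Qed.

(** Classical logic extracts from the failure of [TC] an actual offending run, and each of the two
    kinds of run is the last premise block of one clause. *)
Lemma ill_typed_complete p :
  ~ TC_pairs p -> derivable program (Cantor.to_nat (code_sym SIllTyped, code_pair p)).
Proof.
  destruct p as [[e He] t]. unfold TC_pairs, TC, code_pair. cbn [fst snd proj1_sig].
  intros H. apply not_and_or in H.
  assert (Hscope : derivable program (fact SScoped 0 (code_expr e) 0 0)).
  { apply (scoped_complete e []). rewrite He. apply incl_refl. }
  assert (Hcheck : derivable program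
            (fact SChecker (code_ty t) (code_expr e) 0 (code_expr (checker t e)))).
  { pose proof (proj1 (checker_generator_complete t) e) as Hc.
    now rewrite He in Hc. }
  destruct H as [H|H].
  - apply NNPP in H.
    by_clause ill_typed_clauses 0; [exact Hscope | exact Hcheck | exact (steps_complete _ _ H)].
  - apply not_all_ex_not in H as [v H]. apply imply_to_and in H as [Hv H].
    apply imply_to_and in H as [Hs Hne].
    by_clause ill_typed_clauses 1;
      [exact Hscope | exact Hcheck | exact (steps_complete _ _ Hs) | exact (kind_complete _ Hv) |].
    apply neq_complete. intros E. now apply (code_expr_inj v (EBool true)) in E.
Qed.

Lemma ill_typed_iff n :
  derivable program (Cantor.to_nat (code_sym SIllTyped, n)) <->
  exists p, code_pair p = n /\ ~ TC_pairs p.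
Proof.
  split; [|intros [p [<- H]]; now apply ill_typed_complete].
  intros H. apply program_sound in H.
  rewrite <- (Cantor.cancel_to_of n) in H |- *. destruct (Cantor.of_nat n) as [a m].
  rewrite <- (Cantor.cancel_to_of m) in H |- *. destruct (Cantor.of_nat m) as [b k].
  rewrite <- (Cantor.cancel_to_of k) in H |- *. destruct (Cantor.of_nat k) as [c d].
  exact (H SIllTyped a b c d eq_refl).
Qed.

Theorem lemma3p7 : co_recursively_enumerable TC_pairs.
Proof.
  destruct (derivable_re program (code_sym SIllTyped)) as [f Hf].
  exists f. intros n. rewrite <- Hf. symmetry. apply ill_typed_iff.
Qed.
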